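(* Let $X$ be a weighted graph as in the context, $M\in\{A,L\}$, and let $u$ and $v$ be twin vertices that are strongly cospectral and periodic with minimum period $\rho$, with $\sigma_u^+(M)=\{\lambda_1,\ldots,\lambda_r\}$ ($r\ge2$), $\sigma_u^-(M)=\{\theta\}$ where $\theta$ is as in the context, and $\lambda_1>\lambda_2$. For $j\ne1$ let $p_j,q_j,p_\theta,q_\theta$ be integers with $\gcd(p_j,q_j)=\gcd(p_\theta,q_\theta)=1$ and $$\frac{\lambda_1-\lambda_j}{\lambda_1-\lambda_2}=\frac{p_j}{q_j},\qquad \frac{\lambda_1-\theta}{\lambda_1-\lambda_2}=\frac{p_\theta}{q_\theta}.$$ Let $q=\operatorname{lcm}\{q_2,\ldots,q_r\}$, $\tau=\frac{2\pi q}{\lambda_1-\lambda_2}$, $\gamma\equiv\frac{\tau(\lambda_1-\theta)}{2}\pmod{2\pi}$ and $\zeta\equiv\frac{\tau(\lambda_1+\theta)}{2}\pmod{2\pi}$. Then $U(\tau)\mathbf e_u=e^{i\zeta}\cos\gamma\,\mathbf e_u+ie^{i\zeta}\sin\gamma\,\mathbf e_v$ (fractional revival between $u$ and $v$ at time $\tau$). This fractional revival is proper if and only if $q_\theta$ does not divide $q$, in which case $\tau<\rho$; it is balanced if and only if $q_\theta$ divides $4q$ and $4q/q_\theta$ and $p_\theta$ are odd integers, in which case $\tau=\rho/4$. Moreover, it is perfect state transfer if and only if $2q/q_\theta$ and $p_\theta$ are odd integers, in which case $\tau=\rho/2$.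
   Context: $X$ is a connected weighted undirected graph (finite vertex set, no multiple edges, loops allowed, all edge/loop weights nonzero reals); $A$ is the weighted adjacency matrix, $D$ the diagonal degree matrix with $\deg(u)=2\omega_{u,u}+\sum_j\omega_{u,j}$, $L=D-A$; $U(t)=e^{itM}$. Distinct vertices $u,v$ are twins if they have the same neighbours outside $\{u,v\}$, edges from $u$ and $v$ to each common neighbour have equal weights, and their loops have equal weight (zero if absent); $\omega$ is the common loop weight (0 if none) and $\eta$ the weight of edge $uv$ (0 if non-adjacent); $\theta=\omega-\eta$ if $M=A$ and $\theta=\deg(u)-\omega+\eta$ if $M=L$. With spectral decomposition $M=\sum_j\lambda_jE_j$, $\sigma_u(M)=\{\lambda_j:E_j\mathbf e_u\ne\mathbf 0\}$; strongly cospectral means $E_j\mathbf e_u=\pm E_j\mathbf e_v$ for all $j$, and $\sigma_u^{\pm}(M)$ are the eigenvalues in $\sigma_u(M)$ with $E_j\mathbf e_u=\pm E_j\mathbf e_v$. Periodic: $|U(\tau)_{u,u}|=1$ for some $\tau>0$; minimum period is the least such $\tau$. Fractional revival $U(\tau)\mathbf e_u=\alpha\mathbf e_u+\beta\mathbf e_v$ is proper if $\beta\neq0$, balanced if $|\alpha|=|\beta|$; perfect state transfer means $|U(\tau)_{u,v}|=1$. *)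

(* Defs.v *)
From HB Require Import structures.
From mathcomp Require Export all_boot all_order all_algebra.
From mathcomp Require Export all_classical all_reals all_analysis.
From mathcomp Require Export complex.

Set Implicit Arguments.
Unset Strict Implicit.
Unset Printing Implicit Defensive.

Import Order.TTheory GRing.Theory Num.Theory.

Local Open Scope classical_set_scope.
Local Open Scope ring_scope.
Local Open Scope complex_scope.

(* Vertex set 'I_n. A zero weight means that the edge (or loop) is absent, so
   edges and loops carry nonzero weights and there are no multiple edges. *)
Record wgraph (R : realType) (n : nat) := WGraph {
  weight : 'I_n -> 'I_n -> R ;
  weight_sym : forall i j, weight i j = weight j i }.

(* The choice of M: the adjacency matrix A or the Laplacian matrix L. *)
Variant hamiltonian := Adjacency | Laplacian.

Section Graph.
Variables (R : realType) (n : nat) (X : wgraph R n).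
Local Notation w := (weight X).

Definition edge : rel 'I_n := fun i j => w i j != 0.

Definition connected_graph : Prop := forall i j, connect edge i j.

(* The second summand ranges over the non-loop edges at i: a loop is counted
   exactly twice. *)
Definition deg (i : 'I_n) : R := w i i *+ 2 + \sum_(j < n | j != i) w i j.

Definition adjmx : 'M[R]_n := \matrix_(i, j) w i j.

Definition degmx : 'M[R]_n := diag_mx (\row_i deg i).

Definition lapmx : 'M[R]_n := degmx - adjmx.

Definition graphmx (H : hamiltonian) : 'M[R]_n :=
  match H with Adjacency => adjmx | Laplacian => lapmx end.

Definition twins (u v : 'I_n) : Prop :=
  [/\ u != v,
      forall j, j != u -> j != v -> edge u j = edge v j,
      forall j, j != u -> j != v -> edge u j -> edge v j -> w u j = w v j
    & w u u = w v v].

(* Here omega = w u u and eta = w u v, which are 0 when there is no loop,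
   respectively no edge. *)
Definition twin_theta (H : hamiltonian) (u v : 'I_n) : R :=
  match H with
  | Adjacency => w u u - w u v
  | Laplacian => deg u - w u u + w u v
  end.

End Graph.

Section Spectral.
Variables (R : realType) (n : nat).
Implicit Types (M : 'M[R]_n) (u v : 'I_n).

Definition stdvec (K : pzSemiRingType) (u : 'I_n) : 'cV[K]_n := delta_mx u 0.

(* The orthogonal projection onto the eigenspace of M for a: the projection
   along the orthogonal complement {x | x *m W^T = 0} of the row space of W.
   For symmetric M and eigenvalue a this is the idempotent E_j attached to a
   in the spectral decomposition of M; it is 0 if a is not an eigenvalue. *)
Definition eigenproj M (a : R) : 'M[R]_n :=
  let W := eigenspace M a in proj_mx W (kermx W^T).

Definition eigensupport M u : set R :=
  [set a | eigenproj M a *m stdvec R u != 0].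

Definition strongly_cospectral M u v : Prop :=
  forall a, eigenproj M a *m stdvec R u = eigenproj M a *m stdvec R v \/
            eigenproj M a *m stdvec R u = - (eigenproj M a *m stdvec R v).

Definition eigensupport_plus M u v : set R :=
  [set a | eigensupport M u a /\
           eigenproj M a *m stdvec R u = eigenproj M a *m stdvec R v].

Definition eigensupport_minus M u v : set R :=
  [set a | eigensupport M u a /\
           eigenproj M a *m stdvec R u = - (eigenproj M a *m stdvec R v)].

End Spectral.

Section Walk.
Variables (R : realType) (n : nat).
Implicit Types (M : 'M[R]_n) (u v : 'I_n) (t : R).

(* Matrix exponential: the sum of the power series, computed entrywise. R[i]^o
   carries the topology of the modulus. *)
Definition expmx (B : 'M[R[i]]_n) : 'M[R[i]]_n :=
  \matrix_(i, j)
    limn (fun N : nat => (\sum_(k < N) (k`!%:R)^-1 *: B ^+ k) i j : R[i]^o).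

Definition transition M t : 'M[R[i]]_n :=
  expmx ((t%:C * 'i) *: map_mx (fun x : R => x%:C) M).

Definition expi (x : R) : R[i] := cos x +i* sin x.

Definition periodic_at M u t : Prop := `|transition M t u u| = 1.

Definition min_period M u (rho : R) : Prop :=
  [/\ 0 < rho, periodic_at M u rho
    & forall t, 0 < t -> periodic_at M u t -> rho <= t].

Definition fractional_revival M u v t (alpha beta : R[i]) : Prop :=
  transition M t *m stdvec R[i] u
  = alpha *: stdvec R[i] u + beta *: stdvec R[i] v.

Definition proper_fr M u v t : Prop :=
  exists alpha beta, fractional_revival M u v t alpha beta /\ beta != 0.

Definition balanced_fr M u v t : Prop :=
  exists alpha beta,
    fractional_revival M u v t alpha beta /\ `|alpha| = `|beta|.

Definition pst M u v t : Prop := `|transition M t u v| = 1.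

End Walk.

Definition eqmod2pi (R : realType) (x y : R) : Prop :=
  exists k : int, x - y = k%:~R * (2 * pi).

Definition oddz (a : int) : bool := ~~ (2 %| a)%Z.

(* Main.v *)
(** Since [M] is real symmetric, its eigenprojections [E_a] are symmetric
    idempotents with sum 1, and [U(t) = \sum_a exp(i t a) E_a]. At time [tau]
    all phases [tau * lam_j] agree modulo [2 pi], because [q_j] divides [Q];
    hence [U(tau) e_u] is a combination of [e_u + e_v], with phase
    [tau * lam_1], and of [e_u - e_v], with phase [tau * theta]. Properness,
    balance and perfect transfer then say that [x], [2 x], [4 x] are or are
    not integers, where [gamma = pi x] and [x = Q p_theta / q_theta].

    The diagonal entry [U(t)_uu = \sum_a w_a exp(i t a)] is a convex
    combination of unit complex numbers, so it has modulus 1 exactly when all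
    phases in the support of [u] agree. Hence [rho = 2 pi m / (lam_1 - lam_2)]
    for the least positive integer [m] divisible by [Q] and [q_theta], and
    comparing [m] with [Q], [2 Q] and [4 Q] gives the claims on [tau]. *)
Require Import Defs.
From mathcomp Require Import ring lra zify.

Set Implicit Arguments.
Unset Strict Implicit.

Import Order.TTheory GRing.Theory Num.Theory.
Import numFieldNormedType.Exports.

Local Open Scope classical_set_scope.
Local Open Scope ring_scope.
Local Open Scope complex_scope.

(** * Spectral projections of a real symmetric matrix *)

(* Over [R[i]] the matrix is Hermitian, so its minimal polynomial is a product
   of distinct linear factors with real roots; it is also the image of the
   minimal polynomial over [R]. *)
Lemma symmetric_diagonalizable (R : rcfType) (n : nat) (M : 'M[R]_n) :
  M^T = M -> diagonalizable M.
Proof.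
case: n M => [|n] M Msym.
  by exists 1%:M; rewrite ?unitmx1 //; apply/is_diag_mxP => -[].
apply/diagonalizableP.
pose A : 'M[R[i]]_n.+1 := map_mx (real_complex R) M.
have Aherm : A \is hermsymmx.
  apply: realsym_hermsym.
    by apply/eqP; rewrite expr0 scale1r map_mx_id // /A map_trmx Msym.
  by apply/mxOverP => i j; rewrite mxE; apply/complex_realP; exists (M i j).
have /orthomx_spectralP AE := hermitian_normalmx Aherm.
have /mxOverP dreal := hermitian_spectral_diag_real Aherm.
have [sp spE] : exists d : 'rV[R]_n.+1,
    spectral_diag A = map_mx (real_complex R) d.
  exists (map_mx (@complex.Re R) (spectral_diag A)).
  by apply/rowP => j; rewrite !mxE RRe_real.
exists (undup [seq sp 0 i | i <- enum 'I_n.+1]); first exact: undup_uniq.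
rewrite -(dvdp_map (real_complex R)) -mxminpoly_map -/A {1}AE.
rewrite -[X in invmx X *m _ *m X]/(spectralmx A).
have Pu := spectral_unit A.
rewrite -{2}[spectralmx A]invmxK -conjumx ?unitmx_inv //.
rewrite mxminpoly_uconj ?unitmx_inv // spE -map_diag_mx mxminpoly_map.
by rewrite mxminpoly_diag.
Qed.

Lemma trmx_mul_eq0 (R : realDomainType) (m n : nat) (A : 'M[R]_(m, n)) :
  A *m A^T = 0 -> A = 0.
Proof.
move=> AAT; apply/matrixP => i j; rewrite mxE.
have /matrixP/(_ i i) := AAT; rewrite !mxE => /eqP.
under eq_bigr do rewrite mxE -expr2.
by rewrite psumr_eq0 => [/allP/(_ j)|k _]; rewrite ?sqr_ge0 // mem_index_enum
  sqrf_eq0 => /(_ isT)/eqP.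
Qed.

(** A vector [y *m W] killed by [W^T] is orthogonal to itself, and over an ordered field this makes
    it zero. This is the trivial intersection under which the [proj_mx] in [eigenproj] is a genuine
    projection. *)
Lemma capmx_orthogonal (R : realFieldType) (m n : nat) (W : 'M[R]_(m, n)) :
  (W :&: kermx W^T)%MS = 0.
Proof.
apply/eqP; rewrite -submx0; apply/rV_subP => x.
rewrite sub_capmx => /andP[/submxP[y ->]] /sub_kermxP yWWT.
suff -> : y *m W = 0 by rewrite sub0mx.
by apply: trmx_mul_eq0; rewrite trmx_mul mulmxA yWWT mul0mx.
Qed.

Section EigenProjections.
Variables (R : realType) (n : nat) (M : 'M[R]_n).
Hypothesis Msym : M^T = M.
Local Notation E := (eigenproj M).

(** For [a != b], evaluating [W_b M W_a^T] from either side gives [a] and [b] times [W_b W_a^T], by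
    symmetry of [M]. So distinct eigenspaces are orthogonal, and [W_b] lies in the complement that
    [E a] kills. *)
Lemma eigenspace_mul_eigenproj (a b : R) :
  eigenspace M b *m E a = if a == b then eigenspace M b else 0.
Proof.
case: eqP => [->|/eqP neq_ab].
  by rewrite /eigenproj proj_mx_id ?capmx_orthogonal.
rewrite /eigenproj proj_mx_0 ?capmx_orthogonal //; apply/sub_kermxP.
have eigM c : eigenspace M c *m M = c *: eigenspace M c by apply/eigenspaceP.
have /eqP : a *: (eigenspace M b *m (eigenspace M a)^T)
    = b *: (eigenspace M b *m (eigenspace M a)^T).
  by rewrite scalemxAr -linearZ /= -eigM trmx_mul Msym mulmxA eigM -scalemxAl.
by rewrite -subr_eq0 -scalerBl scaler_eq0 subr_eq0 (negPf neq_ab) => /eqP.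
Qed.

Lemma eigenproj_mulr (a : R) : E a *m M = a *: E a.
Proof. by apply/eigenspaceP; rewrite -[X in (X <= _)%MS]mul1mx proj_mx_sub. Qed.

(** Diagonalizability provides a list of eigenspaces spanning the whole space, and [\sum E a - 1]
    vanishes on each of them. *)
Lemma sum_eigenproj :
  exists2 s : seq R, uniq s & \sum_(a <- s) E a = 1%:M.
Proof.
have /diagonalizablePeigen[s s_uniq sumW] := symmetric_diagonalizable Msym.
exists s => //; apply/eqP; rewrite -subr_eq0 -[X in X == _]mul1mx.
apply/eqP/sub_kermxP; rewrite -sumW.
rewrite big_seq_cond; elim/big_rec: _ => [|b U]; first exact: sub0mx.
rewrite andbT => bs UK; rewrite addsmx_sub UK andbT; apply/sub_kermxP.
rewrite mulmxBr mulmx1 mulmx_sumr (bigD1_seq b) //= big1 => [|a ab].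
  by rewrite eigenspace_mul_eigenproj eqxx addr0 subrr.
by rewrite eigenspace_mul_eigenproj (negPf ab).
Qed.

Lemma eigenproj_mul (a b : R) : E b *m E a = if a == b then E b else 0.
Proof.
have /submxP[B EbE] : (E b <= eigenspace M b)%MS.
  by rewrite -[X in (X <= _)%MS]mul1mx proj_mx_sub.
rewrite EbE -mulmxA eigenspace_mul_eigenproj.
by case: eqP => // _; rewrite mulmx0.
Qed.

(** Eigenspaces consist of row vectors, so only [E a *m M] is immediate. Inserting [1 = \sum E b] on
    the left moves [M] to the other side. *)
Lemma eigenproj_mull (a : R) : M *m E a = a *: E a.
Proof.
have [s s_uniq sumE] := sum_eigenproj.
have -> : M *m E a = \sum_(b <- s) E b *m M *m E a.
  by rewrite -!mulmx_suml sumE mul1mx.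
have -> : a *: E a = \sum_(b <- s) a *: (E b *m E a).
  by rewrite -scaler_sumr -mulmx_suml sumE mul1mx.
apply: eq_bigr => b _; rewrite eigenproj_mulr -scalemxAl eigenproj_mul.
by case: eqP => [->|_] //; rewrite !scaler0.
Qed.

(** Symmetry of [M] forces [(E b)^T *m E a = 0] for [b != a]. Summing over [b] leaves
    [E a = (E a)^T *m E a], which is visibly symmetric. *)
Lemma trmx_eigenproj (a : R) : (E a)^T = E a.
Proof.
have [s s_uniq sumE] := sum_eigenproj.
have EtE b : b != a -> (E b)^T *m E a = 0.
  move=> neq_ba; apply/eqP.
  have /eqP : b *: ((E b)^T *m E a) = a *: ((E b)^T *m E a).
    rewrite [RHS]scalemxAr -eigenproj_mull scalemxAl.
    have -> : b *: (E b)^T = (b *: E b)^T by rewrite linearZ.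
    by rewrite -eigenproj_mull trmx_mul Msym; exact/esym/mulmxA.
  by rewrite -subr_eq0 -scalerBl scaler_eq0 subr_eq0 (negPf neq_ba).
have EtEa : (E a)^T *m E a = E a.
  have EaE : E a = \sum_(b <- s) (E b)^T *m E a.
    by rewrite -mulmx_suml -linear_sum /= sumE trmx1 mul1mx.
  have [a_s|a_s] := boolP (a \in s).
    by rewrite [RHS]EaE (bigD1_seq a) //= big1 ?addr0 // => b; exact: EtE.
  have -> : E a = 0; last by rewrite mulmx0.
  rewrite EaE big_seq big1 // => b bs.
  by rewrite EtE //; apply: contraNneq a_s => <-.
by rewrite -EtEa trmx_mul trmxK.
Qed.

(** Since [E a = (E a)^T *m E a], the diagonal entry is the squared norm of [E a e_u]. Hence it is
    nonnegative, and positive exactly on the support of [u]. *)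
Lemma eigenproj_diagE (a : R) (u : 'I_n) :
  E a u u = \sum_i (E a *m stdvec R u) i 0 ^+ 2.
Proof.
have : (E a)^T *m E a = E a by rewrite trmx_eigenproj eigenproj_mul eqxx.
move: (E a) => P PtP; rewrite -[in LHS]PtP mxE.
by apply: eq_bigr => i _; rewrite /stdvec -colE !mxE -expr2.
Qed.

Lemma eigenproj_diag_ge0 (a : R) (u : 'I_n) : 0 <= E a u u.
Proof. by rewrite eigenproj_diagE sumr_ge0 // => i _; exact: sqr_ge0. Qed.

Lemma eigensupportE (a : R) (u : 'I_n) :
  eigensupport M u a <-> E a u u != 0.
Proof.
rewrite /eigensupport /= eigenproj_diagE psumr_eq0 => [|i _]; last first.
  exact: sqr_ge0.
split.
  apply: contra => /allP Eu0; apply/eqP/colP => i; rewrite [RHS]mxE; apply/eqP.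
  by rewrite -sqrf_eq0; exact: Eu0 (mem_index_enum i).
by apply: contra => /eqP ->; apply/allP => i _; rewrite /= mxE expr0n /=.
Qed.

End EigenProjections.

(** * The transition matrix *)

Lemma cvg_complex (R : realType) (x y : nat -> R) (a b : R) :
  x @ \oo --> a -> y @ \oo --> b ->
  (fun N => x N +i* y N : R[i]^o) @ \oo --> (a +i* b : R[i]^o).
Proof.
move=> xa yb; apply/cvgrPdist_lt => -[e e'].
(* Positivity in [R[i]] means that [e] is real and positive. *)
rewrite ltcE /= => /andP[/eqP -> e_gt0].
have e2_gt0 : 0 < e / 2 by rewrite divr_gt0.
near=> N.
rewrite -[_ - _]/((a - x N) +i* (b - y N)) normc_def /= ltcR.
have xN : `|a - x N| < e / 2 by near: N; move/cvgrPdist_lt: xa; apply.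
have yN : `|b - y N| < e / 2 by near: N; move/cvgrPdist_lt: yb; apply.
rewrite -(ltr_pXn2r (n := 2)) ?nnegrE ?sqrtr_ge0 ?(ltW e_gt0) //.
rewrite sqr_sqrtr ?addr_ge0 ?sqr_ge0 // [in ltRHS](splitr e).
rewrite -(real_normK (num_real (a - _))) -(real_normK (num_real (b - _))).
rewrite (@lt_le_trans _ _ ((e / 2) ^+ 2 + (e / 2) ^+ 2)) //.
  by rewrite ltrD // ltr_pXn2r ?nnegrE // ltW.
by rewrite sqrrD lerD2r lerDl mulrn_wge0 // mulr_ge0 ?ltW.
Unshelve. all: by end_near.
Qed.

Lemma expi_coeffE (R : realType) (x : R) (k : nat) :
  (k`!%:R)^-1 * (x%:C * 'i) ^+ k = cos_coeff x k +i* sin_coeff x k.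
Proof.
rewrite /cos_coeff /sin_coeff /= exprMn -rmorphXn /=.
have -> : (k`!%:R)^-1 = ((k`!%:R)^-1)%:C :> R[i] by rewrite fmorphV rmorph_nat.
(* The parity of [k] decides which component survives. The exponent [k.-1./2] is that of
   [sin_coeff]; it equals [k./2] for odd [k], and for even [k] its term is multiplied by 0. *)
have -> : 'i ^+ k = ((~~ odd k)%:R * (-1) ^+ k./2) +i*
    ((odd k)%:R * (-1) ^+ k.-1./2) :> R[i].
  rewrite -{1}(odd_double_half k) exprD -mul2n exprM sqr_i.
  have -> : (-1) ^+ k./2 = ((-1) ^+ k./2)%:C :> R[i].
    by rewrite rmorphXn rmorphN1.
  case: k => [|k]; first by rewrite /= !expr0 mul0r; simpc.
  rewrite /= uphalf_half; case: (odd k) => /=;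
    by rewrite ?mul0r ?mul1r ?expr0 ?expr1 ?add0n; simpc.
by simpc; rewrite -exprnP; congr (_ +i* _); ring.
Qed.

Lemma cvg_expi (R : realType) (x : R) :
  (fun N => \sum_(k < N) (k`!%:R)^-1 * (x%:C * 'i) ^+ k : R[i]^o) @ \oo
    --> (expi x : R[i]^o).
Proof.
have -> : (fun N => \sum_(k < N) (k`!%:R)^-1 * (x%:C * 'i) ^+ k : R[i]^o)
    = (fun N => series (cos_coeff x) N +i* series (sin_coeff x) N).
  apply/funext; elim=> [|N IH]; first by rewrite big_ord0 /series /= !big_geq.
  by rewrite big_ord_recr /= IH expi_coeffE !seriesSr.
apply: cvg_complex.
- have -> : cos x = limn (series (cos_coeff x)) by rewrite unlock.
  exact: (@is_cvg_series_cos_coeff R x).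
- have -> : sin x = limn (series (sin_coeff x)) by rewrite unlock.
  exact: (@is_cvg_series_sin_coeff R x).
Qed.

Section Transition.
Variables (R : realType) (n : nat) (M : 'M[R]_n) (s : seq R).
Hypothesis Msym : M^T = M.
Hypothesis sumE : \sum_(a <- s) eigenproj M a = 1%:M.
Local Notation toC := (map_mx (real_complex R)).

Lemma symmetric_expE (c : R[i]) (k : nat) :
  (c *: toC M) ^+ k = \sum_(a <- s) (a%:C * c) ^+ k *: toC (eigenproj M a).
Proof.
elim: k => [|k IH].
  under eq_bigr do rewrite expr0 scale1r.
  by rewrite -map_mx_sum sumE map_mx1 expr0.
rewrite exprS IH mulr_sumr; apply: eq_bigr => a _.
rewrite -[_ * _]/(_ *m _) -scalemxAr -scalemxAl -map_mxM.
rewrite eigenproj_mull // map_mxZ !scalerA exprS.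
by congr (_ *: _); rewrite /=; ring.
Qed.

(** The spectral expansion of the powers and an exchange of finite sums turn each entry of the
    partial sums into a combination of exponential partial sums, one per eigenvalue. *)
Lemma transitionE (t : R) :
  transition M t = \sum_(a <- s) expi (t * a) *: toC (eigenproj M a).
Proof.
apply/matrixP => i j; rewrite /transition /expmx mxE summxE.
apply: (@cvg_lim R[i]^o); first exact: norm_hausdorff.
have -> : (fun N => (\sum_(k < N) k`!%:R^-1 *: ((t%:C * 'i) *: toC M) ^+ k) i j)
  = (fun N => \sum_(a <- s)
       (\sum_(k < N) (k`!%:R)^-1 * ((t * a)%:C * 'i) ^+ k) *
       (eigenproj M a i j)%:C).
  apply/funext => N; rewrite summxE.
  under [RHS]eq_bigr do rewrite mulr_suml.
  rewrite exchange_big /=; apply: eq_bigr => k _.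
  rewrite mxE symmetric_expE summxE mulr_sumr; apply: eq_bigr => a _.
  rewrite 2!mxE -[in RHS]mulrA; congr (_ * (_ ^+ _ * _)).
  by rewrite rmorphM mulrA [_%:C * _]mulrC.
under eq_bigr do rewrite 2!mxE.
apply: cvg_big => [|a _]; first exact: add_continuous.
apply: cvgMr_tmp; exact: cvg_expi.
Qed.
End Transition.

(** * Angles and divisibility *)

Section Trigonometry.
Variable R : realType.
Implicit Types x y z : R.

Lemma sin_pi_int (k : int) : sin (pi * k%:~R) = 0 :> R.
Proof.
have H (m : nat) : sin (pi * m%:R) = 0 :> R.
  by rewrite mulr_natr -[_ *+ _]add0r (alternatingn (@sinDpi R)) sin0 mulr0.
by case: k => m; rewrite ?NegzE ?mulrNz ?mulrN ?sinN -pmulrn H ?oppr0.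
Qed.

Lemma sin_pi_eq0 y : sin (pi * y) = 0 <-> exists k : int, y = k%:~R.
Proof.
split=> [siny|[k ->]]; last exact: sin_pi_int.
(* The fractional part of [y] lies in [0, 1). Its sine also vanishes, but the sine is positive on
   the open interval from 0 to [pi]. *)
exists (Num.floor y).
have /andP[le_fy lt_yf] := floor_itv y.
have : sin (pi * (y - (Num.floor y)%:~R)) = 0.
  by rewrite mulrBr sinB siny sin_pi_int mul0r mulr0 subrr.
have [/eqP|neq0] := eqVneq (y - (Num.floor y)%:~R) 0.
  by rewrite subr_eq0 => /eqP.
have : 0 < sin (pi * (y - (Num.floor y)%:~R)); last by move=> /gt_eqF/eqP.
apply: sin_gt0_pi.
rewrite mulr_gt0 ?pi_gt0 //=; last by rewrite lt_def neq0 subr_ge0.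
rewrite gtr_pMr ?pi_gt0 // ltrBlDl.
by rewrite intrD in lt_yf.
Qed.

(** From sin 2z = 2 sin z cos z: the cosine vanishes exactly when sin 2z does and sin z does not.
    This form matches the divisibility conditions on [2 * N] and [N]. *)
Lemma cos_pi_eq0 y :
  cos (pi * y) = 0 <->
  (exists k : int, 2 * y = k%:~R) /\ ~ (exists k : int, y = k%:~R).
Proof.
rewrite -!sin_pi_eq0 mulrCA mulr_natl sin_mulr2n.
have H := cos2Dsin2 (pi * y).
split=> [c0|[/eqP]].
  rewrite c0 mul0r mul0rn; split=> // s0.
  by move: H; rewrite c0 s0 expr0n addr0 => /eqP; rewrite eq_sym oner_eq0.
by rewrite mulrn_eq0 mulf_eq0 /= => /orP[/eqP|/eqP].
Qed.

Lemma cos_eq1 z : cos z = 1 <-> exists k : int, z = k%:~R * (2 * pi).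
Proof.
have zE : z = (pi * (z / (2 * pi))) *+ 2.
  have pi0 : pi != 0 :> R by rewrite gt_eqF ?pi_gt0.
  by rewrite -mulr_natl mulrA mulrC divfK // mulf_neq0.
have cos1 : cos z = 1 <-> sin (pi * (z / (2 * pi))) = 0.
  rewrite {1}zE cos_mulr2n cos2sin2; set w := sin _.
  split=> [w1|->]; last by lra.
  by apply/eqP; rewrite -sqrf_eq0; apply/eqP; lra.
rewrite cos1 sin_pi_eq0; split=> -[k kE]; exists k.
  by rewrite -kE mulfVK // mulf_neq0 ?gt_eqF ?pi_gt0.
by rewrite kE mulfK // mulf_neq0 ?gt_eqF ?pi_gt0.
Qed.

Lemma expiD x y : expi (x + y) = expi x * expi y.
Proof. by rewrite /expi cosD sinD; simpc; congr (_ +i* _); ring. Qed.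

Lemma norm_expi x : `|expi x| = 1.
Proof. by rewrite normc_def /= cos2Dsin2 sqrtr1. Qed.

Lemma cos_eq1_expi z : cos z = 1 -> expi z = 1.
Proof.
move=> c1; rewrite /expi c1; have := cos2Dsin2 z; rewrite c1 expr1n.
move=> /eqP; rewrite -subr_eq0 addrAC subrr add0r sqrf_eq0 => /eqP ->.
by [].
Qed.

Lemma eqmod2pi_expi x y : eqmod2pi x y -> expi x = expi y.
Proof.
move=> xy; rewrite -[x](subrK y) expiD cos_eq1_expi ?mul1r //.
exact/cos_eq1.
Qed.

End Trigonometry.

Section Divisibility.

(** Write [2 * N = m * d]. If [d] does not divide [N], then [m] is odd, so [d] is even and [p],
    being coprime to [d], is odd. Conversely, [d] dividing [N] would make the quotient even. *)
Lemma dvdz_double_odd (p d N : int) : d != 0 -> gcdz p d = 1 ->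
  ((d %| 2 * N)%Z /\ ~ (d %| N)%Z) <->
  [/\ (d %| 2 * N)%Z, oddz ((2 * N) %/ d)%Z & oddz p].
Proof.
move=> d0 pd; split=> [[dvd2 ndvd]|[dvd2 odd2 _]]; last first.
  split=> // /dvdzP[m NE]; move: odd2.
  by rewrite /oddz NE mulrA mulzK // dvdz_mulr.
case/dvdzP: (dvd2) => m mE.
have oddm : oddz m.
  apply/negP => /dvdzP[k kE]; apply: ndvd; apply/dvdzP; exists k.
  apply: (@mulfI _ 2) => //; rewrite mE kE; ring.
split=> //; first by rewrite mE mulzK.
apply/negP => dvdp.
have : (2 %| m * d)%Z by rewrite -mE dvdz_mulr.
rewrite Gauss_dvdzr; last first.
  by rewrite coprimezE coprime2n -[odd _]negbK -dvdn2 -(dvdzE 2).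
move=> dvdd; have : (2 %| gcdz p d)%Z by rewrite dvdz_gcd dvdp.
by rewrite pd.
Qed.

Lemma dvdz_lcm (a b d : int) :
  (lcmz a b %| d)%Z = (a %| d)%Z && (b %| d)%Z.
Proof. by rewrite !dvdzE /lcmz absz_nat dvdn_lcm. Qed.

Lemma dvdz_biglcm (m r : nat) (q : nat -> int) (d : int) :
  (\big[lcmz/1]_(m <= j < r) q j %| d)%Z <->
  (forall j, (m <= j < r)%N -> (q j %| d)%Z).
Proof.
split=> [+ j|dvd].
  rewrite -mem_index_iota; elim: (index_iota m r) => // k s IH.
  rewrite big_cons dvdz_lcm in_cons => /andP[kd sd] /orP[/eqP -> //|].
  exact: IH.
rewrite big_seq; elim/big_rec: _ => [|j k]; first exact: dvd1z.
by rewrite mem_index_iota dvdz_lcm => /dvd ->.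
Qed.

Lemma biglcmz_gt0 (m r : nat) (q : nat -> int) :
  (forall j, (m <= j < r)%N -> q j != 0) ->
  0 < \big[lcmz/1]_(m <= j < r) q j.
Proof.
move=> q0; rewrite big_seq; elim/big_rec: _ => // j k.
rewrite mem_index_iota => /q0 qj0 k0.
by rewrite lt_def lcmz_ge0 lcmz_neq0 qj0 gt_eqF.
Qed.

End Divisibility.

Lemma ratio_int (R : numFieldType) (N p d : int) : d != 0 -> gcdz p d = 1 ->
  (exists k : int, N%:~R * (p%:~R / d%:~R) = k%:~R :> R) <-> (d %| N)%Z.
Proof.
move=> d0 pd; have d0R : d%:~R != 0 :> R by rewrite intr_eq0.
split=> [[k]|/dvdzP[m ->]]; last first.
  by exists (m * p); rewrite !intrM mulrCA -mulrA mulrC mulrA; field.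
rewrite mulrA => /(canRL (mulfVK d0R))/eqP; rewrite -!intrM eqr_int => /eqP Np.
rewrite -(@Gauss_dvdzl _ _ p); last by rewrite /coprimez gcdzC pd.
by rewrite Np dvdz_mull.
Qed.

(** All relevant times have the form [2 * pi * N / D] with [N] an integer. At such a time, agreement
    of phases modulo [2 * pi] is divisibility of [N] by the reduced denominator. *)
Lemma phase_int (R : realType) (D b : R) (N p q : int) :
  q != 0 -> gcdz p q = 1 -> b / D = p%:~R / q%:~R ->
  (exists k : int, 2 * pi * N%:~R / D * b = k%:~R * (2 * pi)) <-> (q %| N)%Z.
Proof.
move=> q0 pq bD; rewrite -(ratio_int R N q0 pq) -bD.
have pi2 : 2 * pi != 0 :> R by rewrite mulf_neq0 ?gt_eqF ?pi_gt0.
have -> : 2 * pi * N%:~R / D * b = N%:~R * (b / D) * (2 * pi) by ring.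
split=> -[k kE]; exists k; last by rewrite kE.
exact: mulIf kE.
Qed.

Lemma balanced_angle (R : realType) (y : R) :
  `|cos y| = `|sin y| <-> cos (2 * y) = 0.
Proof.
rewrite mulr_natl cos_mulr2n.
have cs := cos2Dsin2 y.
split=> [/(congr1 (fun z => z ^+ 2))|c0].
  by rewrite !real_normK ?num_real // => e; lra.
apply/eqP; rewrite -(eqrXn2 (n := 2)) // !real_normK ?num_real //.
by apply/eqP; lra.
Qed.

Lemma norm_real_complex (R : rcfType) (x : R) : `|x%:C| = `|x|%:C :> R[i].
Proof. by rewrite normc_def /= expr0n addr0 sqrtr_sqr. Qed.

(** With [x] as [zeta] and [y] as [gamma], this and the next identity put the revival coefficients
    in polar form. *)
Lemma expi_half_sum (R : realType) (x y : R) :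
  (expi (x + y) + expi (x - y)) / 2 = expi x * (cos y)%:C.
Proof.
have two0 : (2 : R[i]) != 0 by rewrite pnatr_eq0.
rewrite !expiD -mulrDr -mulrA; congr (_ * _).
rewrite -[RHS](mulfK two0); congr (_ / _); rewrite mulr_natr mulr2n.
by rewrite /expi cosN sinN; simpc.
Qed.

Lemma expi_half_diff (R : realType) (x y : R) :
  (expi (x + y) - expi (x - y)) / 2 = 'i * expi x * (sin y)%:C.
Proof.
have two0 : (2 : R[i]) != 0 by rewrite pnatr_eq0.
have -> : 'i * expi x * (sin y)%:C = expi x * ('i * (sin y)%:C).
  by rewrite mulrCA mulrA.
rewrite !expiD -mulrBr -mulrA; congr (_ * _).
rewrite -[RHS](mulfK two0); congr (_ / _); rewrite mulr_natr mulr2n.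
by rewrite -complexiE /expi cosN sinN; simpc.
Qed.

(** * Periodicity and revival *)

Lemma graphmx_sym (R : realType) (n : nat) (X : wgraph R n) (H : hamiltonian) :
  (graphmx X H)^T = graphmx X H.
Proof.
have Asym : (adjmx X)^T = adjmx X.
  by apply/matrixP => i j; rewrite !mxE weight_sym.
by case: H => //=; rewrite /lapmx linearB /= Asym /degmx tr_diag_mx.
Qed.

Section ContinuousWalk.
Variables (R : realType) (n : nat) (M : 'M[R]_n).
Hypothesis Msym : M^T = M.
Local Notation E := (eigenproj M).

Lemma transition_sym (t : R) : (transition M t)^T = transition M t.
Proof.
have [s _ sumE] := sum_eigenproj Msym.
rewrite (transitionE Msym sumE) linear_sum /=; apply: eq_bigr => a _.
by rewrite linearZ /= map_trmx trmx_eigenproj.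
Qed.

Lemma periodic_atE (u : 'I_n) (t : R) :
  periodic_at M u t <->
  forall a b, eigensupport M u a -> eigensupport M u b -> cos (t * (a - b)) = 1.
Proof.
have [s s_uniq sumE] := sum_eigenproj Msym.
pose w a : R := E a u u.
have w_ge0 a : 0 <= w a := eigenproj_diag_ge0 Msym a u.
have suppE a : eigensupport M u a <-> w a != 0 :=
  eigensupportE Msym a u.
(* The list [s] contains the whole support: for [a] outside it, every [E b *m E a] with [b] in [s]
   vanishes, hence so does [E a]. *)
have w_s a : w a != 0 -> a \in s.
  apply: contraNT => a_s; rewrite /w.
  rewrite -[E a]mul1mx -sumE mulmx_suml big_seq big1 ?mxE // => b bs.
  by rewrite eigenproj_mul //; case: eqP a_s bs => // -> /negPf ->.
have sum_w : \sum_(a <- s) w a = 1.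
  by have /matrixP/(_ u u) := sumE; rewrite summxE mxE eqxx.
have UuuE : transition M t u u =
    (\sum_(a <- s) w a * cos (t * a)) +i* (\sum_(a <- s) w a * sin (t * a)).
  rewrite (transitionE Msym sumE) summxE.
  elim/big_rec3: _ => // a x y z _ ->.
  by rewrite 2!mxE -/(w a) /expi; simpc; congr (_ +i* _); rewrite mulrC.
(* [1 - |U(t)_uu|^2] is a sum of nonnegative terms, one for each pair of
   eigenvalues. *)
have defect : 1 - ((\sum_(a <- s) w a * cos (t * a)) ^+ 2 +
                   (\sum_(a <- s) w a * sin (t * a)) ^+ 2) =
    \sum_(a <- s) \sum_(b <- s) w a * w b * (1 - cos (t * (a - b))).
  rewrite -[X in X - _ = _](expr1n R 2) -[X in X ^+ 2 - _]sum_w.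
  rewrite !expr2 !mulr_suml -big_split -sumrB /=; apply: eq_bigr => a _.
  rewrite !mulr_sumr -big_split -sumrB /=; apply: eq_bigr => b _.
  by rewrite [t * (_ - _)]mulrBr cosB /=; ring.
have term_ge0 a b : 0 <= w a * w b * (1 - cos (t * (a - b))).
  by rewrite mulr_ge0 ?mulr_ge0 // subr_ge0 cos_le1.
have perE : periodic_at M u t <->
    \sum_(a <- s) \sum_(b <- s) w a * w b * (1 - cos (t * (a - b))) = 0.
  rewrite /periodic_at UuuE -defect.
  split=> [U1|/eqP].
    have := add_Re2_Im2 ((\sum_(a <- s) w a * cos (t * a)) +i*
      (\sum_(a <- s) w a * sin (t * a))).
    by rewrite U1 expr1n => -[->]; rewrite subrr.
  by rewrite subr_eq0 => /eqP U1; rewrite normc_def /= -U1 sqrtr1.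
rewrite perE; split=> [/eqP + a b /suppE wa /suppE wb|cos1].
  rewrite psumr_eq0 => [/allP/(_ a (w_s a wa))|c _]; last exact: sumr_ge0.
  rewrite psumr_eq0 // => /allP/(_ b (w_s b wb)).
  by rewrite /= !mulf_eq0 (negPf wa) (negPf wb) subr_eq0 => /eqP.
rewrite big1 // => a _; rewrite big1 // => b _.
have [-> |wa] := eqVneq (w a) 0; first by rewrite !mul0r.
have [-> |wb] := eqVneq (w b) 0; first by rewrite mulr0 mul0r.
by rewrite cos1 ?subrr ?mulr0 //; apply/suppE.
Qed.

(** Compare both sides after applying each [E a]. The two coefficients add up to [z1] where [E a]
    identifies [e_u] with [e_v], and their difference is [z2] where it identifies [e_u] with
    [- e_v]. Outside the support both sides vanish. *)
Lemma strongly_cospectral_fr (u v : 'I_n) (t : R) (z1 z2 : R[i]) :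
  strongly_cospectral M u v ->
  (forall a, eigensupport_plus M u v a -> expi (t * a) = z1) ->
  (forall a, eigensupport_minus M u v a -> expi (t * a) = z2) ->
  fractional_revival M u v t ((z1 + z2) / 2) ((z1 - z2) / 2).
Proof.
move=> sc plus minus; have [s _ sumE] := sum_eigenproj Msym.
have two0 : (2 : R[i]) != 0 by rewrite pnatr_eq0.
pose F a := map_mx (real_complex R) (E a).
have sumF : \sum_(a <- s) F a = 1%:M.
  by rewrite -map_mx_sum sumE map_mx1.
rewrite /fractional_revival (transitionE Msym sumE) mulmx_suml.
rewrite -[stdvec R[i] u in RHS]mul1mx -[stdvec R[i] v in RHS]mul1mx -sumF.
rewrite !mulmx_suml !scaler_sumr -big_split /=; apply: eq_bigr => a _.
have FE x : F a *m stdvec R[i] x = map_mx (real_complex R) (E a *m stdvec R x).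
  by rewrite map_mxM map_delta_mx.
rewrite -scalemxAl -/(F a) !FE.
have suppN : ~ eigensupport M u a -> E a *m stdvec R u = 0.
  by move/negP; rewrite negbK => /eqP.
case: (sc a) => Eav; have [sa|/suppN] := pselect (eigensupport M u a).
- rewrite (plus a) // -Eav -scalerDl; congr (_ *: _); by field.
- by rewrite -Eav => ->; rewrite map_mx0 !scaler0 addr0.
- rewrite (minus a) //.
  have -> : E a *m stdvec R v = - (E a *m stdvec R u) by rewrite Eav opprK.
  by rewrite map_mxN scalerN -scalerBl; congr (_ *: _); by field.
- move=> E0; have -> : E a *m stdvec R v = - (E a *m stdvec R u).
    by rewrite Eav opprK.
  by rewrite E0 oppr0 map_mx0 !scaler0 addr0.
Qed.

(** As [u != v], the coefficients are entries of column [u] of the transition matrix. Hence they are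
    unique, which resolves the existentials in [proper_fr] and [balanced_fr]. *)
Lemma fractional_revivalE (u v : 'I_n) (t : R) (al be : R[i]) : u != v ->
  fractional_revival M u v t al be ->
  transition M t u u = al /\ transition M t v u = be.
Proof.
move=> uv /colP fr.
have UE i : transition M t i u = (transition M t *m stdvec R[i] u) i 0.
  by rewrite /stdvec -colE [RHS]mxE.
rewrite !UE !fr !mxE !eqxx (negPf uv) eq_sym (negPf uv).
by rewrite !mulr0 !mulr1 addr0 add0r.
Qed.
End ContinuousWalk.

Theorem theorem6p7 (R : realType) (n : nat) (X : wgraph R n)
  (H : hamiltonian) (M : 'M[R]_n) (hM : M = graphmx X H)
  (hX : connected_graph X)
  (u v : 'I_n) (huv : twins X u v)
  (hsc : strongly_cospectral M u v)
  (rho : R) (hrhou : min_period M u rho) (hrhov : min_period M v rho)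
  (theta : R) (htheta : theta = twin_theta X H u v)
  (r : nat) (hr : (2 <= r)%N) (lam : nat -> R)
  (hlam_inj : forall j k : nat, (1 <= j <= r)%N -> (1 <= k <= r)%N ->
     lam j = lam k -> j = k)
  (hplus : eigensupport_plus M u v
     = [set x | exists j : nat, (1 <= j <= r)%N /\ x = lam j])
  (hminus : eigensupport_minus M u v = [set theta])
  (hlam12 : lam 2%N < lam 1%N)
  (p q : nat -> int) (ptheta qtheta : int)
  (hq0 : forall j : nat, (2 <= j <= r)%N -> q j != 0)
  (hpq : forall j : nat, (2 <= j <= r)%N -> gcdz (p j) (q j) = 1)
  (hratio : forall j : nat, (2 <= j <= r)%N ->
     (lam 1%N - lam j) / (lam 1%N - lam 2%N) = (p j)%:~R / (q j)%:~R)
  (hqtheta0 : qtheta != 0)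
  (hpqtheta : gcdz ptheta qtheta = 1)
  (hratiotheta :
     (lam 1%N - theta) / (lam 1%N - lam 2%N) = ptheta%:~R / qtheta%:~R)
  (Q : int) (hQ : Q = \big[lcmz/1]_(2 <= j < r.+1) q j)
  (tau : R) (htau : tau = 2 * pi * Q%:~R / (lam 1%N - lam 2%N))
  (gamma : R) (hgamma : eqmod2pi gamma (tau * (lam 1%N - theta) / 2))
  (zeta : R) (hzeta : eqmod2pi zeta (tau * (lam 1%N + theta) / 2)) :
  fractional_revival M u v tau
    (expi zeta * (cos gamma)%:C) ('i * expi zeta * (sin gamma)%:C)
  /\ ((proper_fr M u v tau <-> ~ (qtheta %| Q)%Z)
      /\ (proper_fr M u v tau -> tau < rho))
  /\ ((balanced_fr M u v tau <->
         [/\ (qtheta %| 4 * Q)%Z, oddz ((4 * Q) %/ qtheta)%Z & oddz ptheta])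
      /\ (balanced_fr M u v tau -> tau = rho / 4))
  /\ ((pst M u v tau <->
         [/\ (qtheta %| 2 * Q)%Z, oddz ((2 * Q) %/ qtheta)%Z & oddz ptheta])
      /\ (pst M u v tau -> tau = rho / 2)).
Proof.
have Msym : M^T = M by rewrite hM graphmx_sym.
have uv : u != v by case: huv.
have pi_gt0R : 0 < 2 * pi :> R by rewrite mulr_gt0 ?pi_gt0.
have pi0 : 2 * pi != 0 :> R by rewrite gt_eqF.
set D := lam 1%N - lam 2%N in hratio hratiotheta htau *.
have D_gt0 : 0 < D by rewrite subr_gt0.
have D0 : D != 0 by rewrite gt_eqF.
have Q_gt0 : 0 < Q by rewrite hQ; apply: biglcmz_gt0.
have Qdvd N : (Q %| N)%Z <-> forall j, (2 <= j <= r)%N -> (q j %| N)%Z.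
  by rewrite hQ dvdz_biglcm.
have phase_lam N j : (1 <= j <= r)%N -> (Q %| N)%Z ->
    exists k : int, 2 * pi * N%:~R / D * (lam 1%N - lam j) = k%:~R * (2 * pi).
  case: j => [|[|j]] // jr QN; first by exists 0; rewrite subrr mulr0 mul0r.
  have jr2 : (2 <= j.+2 <= r)%N by case/andP: jr.
  apply/(phase_int _ (hq0 _ jr2) (hpq _ jr2) (hratio _ jr2)).
  by move/Qdvd: QN; apply.
have phase_theta N : (exists k : int,
    2 * pi * N%:~R / D * (lam 1%N - theta) = k%:~R * (2 * pi))
    <-> (qtheta %| N)%Z.
  exact: phase_int hqtheta0 hpqtheta hratiotheta.
have plusP a : eigensupport_plus M u v a <->
    exists j : nat, (1 <= j <= r)%N /\ a = lam j by rewrite hplus.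
have minusP a : eigensupport_minus M u v a <-> a = theta by rewrite hminus.
have supp_lam j : (1 <= j <= r)%N -> eigensupport M u (lam j).
  move=> jr; have [] // : eigensupport_plus M u v (lam j).
  by apply/plusP; exists j.
have supp_theta : eigensupport M u theta.
  by have [] : eigensupport_minus M u v theta by apply/minusP.
have suppP a : eigensupport M u a ->
    (exists j : nat, (1 <= j <= r)%N /\ a = lam j) \/ a = theta.
  by move=> sa; case: (hsc a) => e; [left; apply/plusP|right; apply/minusP].
(* The integer [m] counts the full turns of the relative phase of [lam 1] and [lam 2] at time [rho].
   Comparing [lam 1] with the other support eigenvalues gives the divisibilities. *)
have [m [rhoE m_gt0 Qm qm]] : exists m : int,
    [/\ rho = 2 * pi * m%:~R / D, 0 < m, (Q %| m)%Z & (qtheta %| m)%Z].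
  have [rho_gt0 /(periodic_atE Msym) per _] := hrhou.
  have lam1 : eigensupport M u (lam 1%N) by apply: supp_lam; rewrite (ltnW hr).
  have /cos_eq1[m] := per _ _ lam1 (supp_lam 2%N hr); rewrite -/D => mE.
  have rhoE : rho = 2 * pi * m%:~R / D.
    by rewrite [2 * pi * _]mulrC -mE mulfK.
  exists m; split=> //.
  - by rewrite -(ltr_int R) -(pmulr_lgt0 _ pi_gt0R) -mE mulr_gt0.
  - apply/Qdvd => j jr.
    apply/(phase_int _ (hq0 _ jr) (hpq _ jr) (hratio _ jr)).
    rewrite -rhoE; apply/cos_eq1; apply: (per _ _ lam1); apply: supp_lam.
    by case/andP: jr => /ltnW ->.
  - apply/phase_theta; rewrite -rhoE; apply/cos_eq1; exact: (per _ _ lam1).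
(* Such an [N] makes [u] periodic at time [2 * pi * N / D], so minimality of [rho] bounds [m]. *)
have m_min N : 0 < N -> (Q %| N)%Z -> (qtheta %| N)%Z -> m <= N.
  move=> N_gt0 QN qN; have [_ _ min_rho] := hrhou.
  have /min_rho : 0 < 2 * pi * N%:~R / D by rewrite divr_gt0 // mulr_gt0 ?ltr0z.
  rewrite rhoE ler_pM2r ?invr_gt0 // ler_pM2l // ler_int; apply.
  have phase a : eigensupport M u a -> exists k : int,
      2 * pi * N%:~R / D * (lam 1%N - a) = k%:~R * (2 * pi).
    by case/suppP => [[j [jr ->]]| ->]; [exact: phase_lam|exact/phase_theta].
  apply/(periodic_atE Msym) => a b /phase[ka kaE] /phase[kb kbE].
  apply/cos_eq1; exists (kb - ka); rewrite intrB mulrBl -kaE -kbE; ring.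
(* Now [rho = d * tau], so the claims on [tau] become [1 < d], [d = 4] and [d = 2]. *)
have [d mE] := dvdzP Qm; rewrite mulrC in mE.
have d_gt0 : 0 < d by rewrite -(pmulr_rgt0 _ Q_gt0) -mE.
have dle c : 0 < c -> (qtheta %| c * Q)%Z -> d <= c.
  move=> c_gt0 qc; rewrite -(ler_pM2l Q_gt0) -mE mulrC.
  by apply: m_min => //; rewrite ?mulr_gt0 ?dvdz_mull.
have tau_rho (c : nat) : d = c -> tau = rho / c%:R.
  move=> dc; rewrite htau rhoE mE dc intrM -pmulrn.
  have c0 : c%:R != 0 :> R by rewrite pnatr_eq0; lia.
  by move: (pi : R) => P; field; rewrite c0 D0.
pose x : R := Q%:~R * (ptheta%:~R / qtheta%:~R).
have int_x c : (exists k : int, c%:~R * x = k%:~R) <-> (qtheta %| c * Q)%Z.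
  have -> : c%:~R * x = (c * Q)%:~R * (ptheta%:~R / qtheta%:~R).
    by rewrite intrM; exact: mulrA.
  exact: ratio_int hqtheta0 hpqtheta.
have gammaE : expi gamma = expi (pi * x).
  rewrite (eqmod2pi_expi hgamma); congr expi.
  by rewrite htau /x -hratiotheta; field.
have cosgE : cos gamma = cos (pi * x) by case: gammaE.
have singE : sin gamma = sin (pi * x) by case: gammaE.
have frE : fractional_revival M u v tau
    (expi zeta * (cos gamma)%:C) ('i * expi zeta * (sin gamma)%:C).
  pose z0 := tau * (lam 1%N + theta) / 2.
  pose g0 := tau * (lam 1%N - theta) / 2.
  have [zE gE] := (eqmod2pi_expi hzeta, eqmod2pi_expi hgamma).
  have [cE sE] : cos gamma = cos g0 /\ sin gamma = sin g0 by case: gE.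
  rewrite zE cE sE -expi_half_sum -expi_half_diff.
  apply: strongly_cospectral_fr => // a.
    case/plusP => j [jr ->].
    have [k kE] := phase_lam Q j jr (dvdzz Q).
    (* Here [z0 + g0 = tau * lam 1], the common phase of the plus part; likewise
       [z0 - g0 = tau * theta]. *)
    have -> : tau * lam j = z0 + g0 + (- k)%:~R * (2 * pi).
      by rewrite mulrNz mulNr -kE -htau /z0 /g0; field.
    have k1 : expi ((- k)%:~R * (2 * pi) : R) = 1.
      by apply/cos_eq1_expi/cos_eq1; exists (- k).
    by rewrite [LHS]expiD k1 mulr1.
  by move/minusP ->; congr expi; rewrite /z0 /g0; field.
have [Uuu Uvu] := fractional_revivalE uv frE.
have fr_uniq al be : fractional_revival M u v tau al be ->
    al = expi zeta * (cos gamma)%:C /\ be = 'i * expi zeta * (sin gamma)%:C.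
  by move/(fractional_revivalE uv); rewrite Uuu Uvu => -[-> ->].
have norm_i : `|'i| = 1 :> R[i].
  by rewrite normc_def /= expr0n expr1n add0r sqrtr1.
have norm_al : `|expi zeta * (cos gamma)%:C| = `|cos gamma|%:C.
  by rewrite normrM norm_expi mul1r norm_real_complex.
have norm_be : `|'i * expi zeta * (sin gamma)%:C| = `|sin gamma|%:C.
  by rewrite !normrM norm_i norm_expi !mul1r norm_real_complex.
have properE : proper_fr M u v tau <-> ~ (qtheta %| Q)%Z.
  rewrite -[Q]mul1r -int_x mul1r -sin_pi_eq0 -singE; split.
    by move=> [al [be [/fr_uniq[_ ->] be0]]] s0; rewrite s0 mulr0 eqxx in be0.
  move=> s0; exists (expi zeta * (cos gamma)%:C),
    ('i * expi zeta * (sin gamma)%:C).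
  split=> //; rewrite -normr_gt0 norm_be ltcR normr_gt0; exact/eqP.
(* Balance means that the cosine of [2 * gamma] vanishes, that is, [4 * x] is an integer and [2 * x]
   is not. *)
have balancedE : balanced_fr M u v tau <->
    (qtheta %| 2 * (2 * Q))%Z /\ ~ (qtheta %| 2 * Q)%Z.
  rewrite mulrA -!int_x.
  have -> : (2 * 2 : int)%:~R * x = 2 * (2 * x) by rewrite intrM mulrA.
  rewrite -cos_pi_eq0 mulrCA -balanced_angle -cosgE -singE; split.
    by move=> [al [be [/fr_uniq[-> ->]]]]; rewrite norm_al norm_be => -[].
  move=> e; exists (expi zeta * (cos gamma)%:C),
    ('i * expi zeta * (sin gamma)%:C).
  by rewrite norm_al norm_be e.
have pstE : pst M u v tau <-> (qtheta %| 2 * Q)%Z /\ ~ (qtheta %| Q)%Z.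
  rewrite -[X in ~ (_ %| X)%Z]mul1r -!int_x mul1r -cos_pi_eq0 -cosgE /pst.
  (* The revival coefficient is the entry at [v u], while [pst] concerns [u v]; symmetry of the
     transition matrix identifies them. *)
  rewrite -(transition_sym Msym) mxE Uvu norm_be; split=> [[/sin1cos0]|c0] //.
  by apply/eqP; rewrite -[1]/(1%:C) (inj_eq (@complexI R)) norm_sin_eq1 c0.
split=> //; split; [|split].
- split=> // /properE nq.
  (* The inequality reduces to [1 < d]; [d = 1] would make [qtheta] divide [Q]. *)
  rewrite htau rhoE ltr_pM2r ?invr_gt0 // ltr_pM2l // ltr_int.
  rewrite mE ltr_pMr //; have := qm; rewrite mE.
  case: (ltrP 1 d) => // d1; have -> : d = 1 by lia.
  by rewrite mulr1.
- split.
    by rewrite balancedE (_ : 4 * Q = 2 * (2 * Q)) ?[RHS]mulrA //;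
      exact: dvdz_double_odd.
  case/balancedE => q4 nq2; apply: (tau_rho 4%N).
  have d4 : d <= 4 by apply: dle => //; rewrite mulrA in q4.
  have qd := qm; rewrite mE in qd.
  (* Each [d < 4] would force [qtheta] to divide [2 * Q], which is excluded. *)
  have [//|dn4] := eqVneq d 4.
  case: nq2.
  have [dE|[dE|dE]] : d = 1 \/ d = 2 \/ d = 3 by lia.
  + by rewrite dE mulr1 in qd; rewrite dvdz_mull.
  + by rewrite dE mulrC in qd.
  (* If [qtheta] divides [4 * Q] and [3 * Q], it divides their difference [Q], with quotient
     [a - b]. *)
  + rewrite dE in qd; case/dvdzP: q4 => a aE; case/dvdzP: qd => b bE.
    by apply/dvdzP; exists (2 * (a - b)); lia.
- split; first by rewrite pstE; exact: dvdz_double_odd.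
  case/pstE => q2 nq; apply: (tau_rho 2%N).
  have d2 := dle 2 isT q2.
  have qd := qm; rewrite mE in qd.
  have [//|dn2] := eqVneq d 2.
  have dE : d = 1 by lia.
  by rewrite dE mulr1 in qd.
Qed.
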